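(* Let $F$ be a distribution function on $\mathbb{R}$, $g:\mathbb{R}^2\to\mathbb{R}$ measurable, and for each $n\in\mathbb{N}$ let $F_n$ be an estimate of $F$ based on $X_1,\dots,X_n$. Let $(\mathbf{V},d)$ be a metric subspace of $\mathbb{D}$ with $d$ homogeneous. Assume that: (a) the regularity conditions (A1)–(A8) listed in the context hold for $g$, $F$ and $(F_n)$; (b) on $\mathbf{V}$ the functions $$\Phi_{i,g}(f):=-\int f(x-)\,dg_{i,F}(x)\ (i=1,2),\qquad \Phi_{3,g}(f):=\iint f(x_1-)f(x_2-)\,dg(x_1,x_2)$$ are well-defined and $(\mathcal{V},\mathcal{B}(\mathbb{R}))$-measurable, and the function $\sum_{i=1}^3\Phi_{i,g}$ is locally $\beta$-Hölder $d$-continuous at the null function for some $\beta>0$; (c) the process $F_n-F$ is a random element of $(\mathbf{V},\mathcal{V})$ for all $n\in\mathbb{N}$, and, for some sequence $(a_n)$ in $(0,\infty)$, $$a_n\,d(F_n-F,0)\longrightarrow0\quad\mathbb{P}\text{-a.s.}$$ Then $$a_n^\beta\big(V_g(F_n)-V_g(F)\big)\longrightarrow0\quad\mathbb{P}\text{-a.s.}$$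
   Context: $(X_i)_{i\in\mathbb{N}}$ is a sequence of random variables on a probability space $(\Omega,\mathcal{F},\mathbb{P})$, identically distributed with distribution function $F$. $V_g(H):=\iint g(x_1,x_2)\,dH(x_1)dH(x_2)$ whenever this exists; $g_{1,F}(x):=\int g(x,x_2)\,dF(x_2)$, $g_{2,F}(x):=\int g(x_1,x)\,dF(x_1)$. $f(x-)$ is the left-hand limit. Integrals without limits are over $(-\infty,\infty)$, $(-\infty,\infty)^2$; $\int_a^b$ is over $(a,b]$. The integral of $f$ w.r.t. a signed measure $\mu$ exists if $\int f^\pm d\mu^\pm$ are all four finite. $\mathbb{D}$ is the space of bounded càdlàg functions on $\overline{\mathbb{R}}=[-\infty,\infty]$, and $\mathcal{D}$ is the $\sigma$-algebra on $\mathbb{D}$ generated by the coordinate projections $f\mapsto f(x)$, $x\in\overline{\mathbb{R}}$. A metric subspace $(\mathbf{V},d)$ of $\mathbb{D}$ is a subset $\mathbf{V}\subset\mathbb{D}$ with a metric $d$, equipped with $\mathcal{V}:=\mathcal{D}\cap\mathbf{V}$ (trace $\sigma$-algebra). $F_n$ and $F$ are regarded as functions on $\overline{\mathbb{R}}$ via their limits at $\pm\infty$. Homogeneity of $d$ means $d(\lambda f,\lambda h)=|\lambda|\,d(f,h)$ for scalars $\lambda$. A functional $\Phi:\mathbf{V}\to\mathbb{R}$ is locally $\beta$-Hölder $d$-continuous at $f\in\mathbf{V}$ if $|\Phi(f_n)-\Phi(f)|=O(d(f_n,f)^\beta)$ for each sequence $(f_n)\subset\mathbf{V}$ with $d(f_n,f)\to0$.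 $\mathbb{BV}_{\mathrm{loc},\mathrm{rc}}$: right-continuous functions $\psi:\mathbb{R}\to\mathbb{R}$ locally of bounded variation; $d\psi=d\psi^+-d\psi^-$ with $d\psi^\pm$ the positive Radon measures from the Jordan decomposition, $|d\psi|=d\psi^++d\psi^-$. A function $\tau:\mathbb{R}^2\to\mathbb{R}$ is locally of bounded variation if for every bounded rectangle $(a_1,a_2]\times(b_1,b_2]$ the supremum over grids $a_1=x_0\le\dots\le x_n=a_2$, $b_1=y_0\le\dots\le y_m=b_2$ of $\sum_{i,j}|\tau(x_i,y_j)-\tau(x_{i-1},y_j)-\tau(x_i,y_{j-1})+\tau(x_{i-1},y_{j-1})|$ is finite. $\mathbb{BV}^2_{\mathrm{loc},\mathrm{rc}}$: upper right-continuous functions $\tau$ on $\mathbb{R}^2$ (i.e. $\tau(y_1,y_2)\to\tau(x_1,x_2)$ as $(y_1,y_2)\to(x_1,x_2)$ with $y_i\ge x_i$) that are locally of bounded variation; $d\tau=d\tau^+-d\tau^-$ is the generated signed measure ($d\tau((a_1,a_2]\times(b_1,b_2])=\tau(a_2,b_2)-\tau(a_1,b_2)-\tau(a_2,b_1)+\tau(a_1,b_1)$), $d\tau^\pm$ the positive Radon measures from the two-dimensional Jordan decomposition, $|d\tau|=d\tau^++d\tau^-$. Conditions, with $H_n:=F_n-F$: (A1) $\iint|g|\,dF\,dF<\infty$; each $F_n$ is a non-decreasing càdlàg process with variation bounded by $1$; for all $n$, $\mathbb{P}$-a.s. $\iint|g|\,dF_n\,dF_n<\infty$. (A2) For all $n$,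 $\mathbb{P}$-a.s. $\iint|g(x_1,x_2)|\,dF_n(x_1)dF(x_2)<\infty$ and $\iint|g(x_1,x_2)|\,dF(x_1)dF_n(x_2)<\infty$. (A3) $g_{1,F},g_{2,F}\in\mathbb{BV}_{\mathrm{loc},\mathrm{rc}}$. (A4) $\int|H_n(x-)|\,|dg_{i,F}|(x)<\infty$ $\mathbb{P}$-a.s. for all $n$ and $i=1,2$. (A5) $\lim_{|x|\to\infty}H_n(x)g_{i,F}(x)=0$ $\mathbb{P}$-a.s. for all $n$ and $i=1,2$. (A6) $g\in\mathbb{BV}^2_{\mathrm{loc},\mathrm{rc}}$, and $g(x_1,\cdot)$ and $g(\cdot,x_2)$ are locally of bounded variation for every fixed $x_1$ and $x_2$, respectively. (A7) $\iint|H_n(x_1-)||H_n(x_2-)|\,|dg|(x_1,x_2)<\infty$ $\mathbb{P}$-a.s. for all $n$. (A8) $\mathbb{P}$-a.s. for all $n$, as $a_1,b_1\to-\infty$, $a_2,b_2\to\infty$ jointly, the following three expressions converge to $0$: $H_n(b_2)\int_{a_1}^{a_2}H_n(x_1-)\,d[g(\cdot,b_2)](x_1)-H_n(b_1)\int_{a_1}^{a_2}H_n(x_1-)\,d[g(\cdot,b_1)](x_1)$; $H_n(a_2)\int_{b_1}^{b_2}H_n(x_2-)\,d[g(a_2,\cdot)](x_2)-H_n(a_1)\int_{b_1}^{b_2}H_n(x_2-)\,d[g(a_1,\cdot)](x_2)$; $H_n(a_2)H_n(b_2)g(a_2,b_2)-H_n(a_1)H_n(b_2)g(a_1,b_2)-H_n(a_2)H_n(b_1)g(a_2,b_1)+H_n(a_1)H_n(b_1)g(a_1,b_1)$.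 (In (A8) the symbols $a_1,a_2,b_1,b_2$ are real interval endpoints, unrelated to the scaling sequence $(a_n)$.)
   Formalization: The formal theorem additionally assumes d(F_n−F,0)→0 P-a.s.; this follows from (c) when (a_n) is bounded away from 0, and without it the claim fails, e.g. F=1_[0,∞), F_n=1_[n,∞), g=x₁x₂, L¹ metric, β=1, a_n=n^{-3/2}. *)

(* Defs.v *)
From HB Require Import structures.
From mathcomp Require Export all_boot all_order all_algebra.
From mathcomp Require Export all_classical all_reals all_analysis.
Export Order.TTheory GRing.Theory Num.Theory.
Export numFieldNormedType.Exports.

#[export] Set Implicit Arguments.
#[export] Unset Strict Implicit.
#[export] Unset Printing Implicit Defensive.

Local Open Scope classical_set_scope.
Local Open Scope ring_scope.

(** * Functions locally of bounded variation, and the measures they generate *)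

Definition locally_BV (R : realType) (psi : R -> R) : Prop :=
  forall a b : R, a <= b -> bounded_variation a b psi.

Definition BV_loc_rc (R : realType) (psi : R -> R) : Prop :=
  right_continuous psi /\ locally_BV psi.

Definition increment2 (R : realType) (tau : R * R -> R) (a1 a2 b1 b2 : R) : R :=
  tau (a2, b2) - tau (a1, b2) - tau (a2, b1) + tau (a1, b1).

Definition locally_BV2 (R : realType) (tau : R * R -> R) : Prop :=
  forall a1 a2 b1 b2 : R, a1 <= a2 -> b1 <= b2 ->
  exists M : R, forall (n m : nat) (x y : nat -> R),
    nondecreasing_seq x -> x 0%N = a1 -> x n = a2 ->
    nondecreasing_seq y -> y 0%N = b1 -> y m = b2 ->
    \sum_(i < n) \sum_(j < m) `|increment2 tau (x i) (x i.+1) (y j) (y j.+1)|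
      <= M.

Definition upper_right_continuous (R : realType) (tau : R * R -> R) : Prop :=
  forall x : R * R,
    tau @ within [set y | x.1 <= y.1 /\ x.2 <= y.2] (nbhs x) --> tau x.

Definition BV2_loc_rc (R : realType) (tau : R * R -> R) : Prop :=
  upper_right_continuous tau /\ locally_BV2 tau.

Definition mutually_singular (d : measure_display) (T : measurableType d)
    (R : realType) (mu nu : set T -> \bar R) : Prop :=
  exists A : set T, [/\ measurable A, mu (~` A) = 0%E & nu A = 0%E].

(** The signed measure generated by [psi] need not be a [charge]: both parts
    may have infinite mass.  It is therefore carried by its Jordan
    decomposition, a pair of mutually singular Radon (locally finite Borel)
    measures.  For [psi] in [BV_loc_rc] such a pair exists and is unique. *)
Record stieltjes (R : realType) (psi : R -> R) := Stieltjes {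
  dpos : {measure set (measurableTypeR R) -> \bar R} ;
  dneg : {measure set (measurableTypeR R) -> \bar R} ;
  dpos_radon : forall a b : R, (dpos `]a, b]%classic < +oo)%E ;
  dneg_radon : forall a b : R, (dneg `]a, b]%classic < +oo)%E ;
  stieltjes_singular : mutually_singular dpos dneg ;
  stieltjesE : forall a b : R, a <= b ->
    fine (dpos `]a, b]%classic) - fine (dneg `]a, b]%classic) = psi b - psi a }.

(** Two-dimensional version, for [tau] in [BV2_loc_rc]. *)
Record stieltjes2 (R : realType) (tau : R * R -> R) := Stieltjes2 {
  dpos2 : {measure set (measurableTypeR R * measurableTypeR R) -> \bar R} ;
  dneg2 : {measure set (measurableTypeR R * measurableTypeR R) -> \bar R} ;
  dpos2_radon : forall a1 a2 b1 b2 : R,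
    (dpos2 (`]a1, a2] `*` `]b1, b2]) < +oo)%E ;
  dneg2_radon : forall a1 a2 b1 b2 : R,
    (dneg2 (`]a1, a2] `*` `]b1, b2]) < +oo)%E ;
  stieltjes2_singular : mutually_singular dpos2 dneg2 ;
  stieltjes2E : forall a1 a2 b1 b2 : R, a1 <= a2 -> b1 <= b2 ->
    fine (dpos2 (`]a1, a2] `*` `]b1, b2]))
      - fine (dneg2 (`]a1, a2] `*` `]b1, b2]))
    = increment2 tau a1 a2 b1 b2 }.

Definition dabs (R : realType) (psi : R -> R) (dpsi : stieltjes psi) :
    {measure set (measurableTypeR R) -> \bar R} :=
  measure_add (dpos dpsi) (dneg dpsi).

Definition dabs2 (R : realType) (tau : R * R -> R) (dtau : stieltjes2 tau) :
    {measure set (measurableTypeR R * measurableTypeR R) -> \bar R} :=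
  measure_add (dpos2 dtau) (dneg2 dtau).

Definition sintegrable (d : measure_display) (T : measurableType d)
    (R : realType) (mup mun : {measure set T -> \bar R}) (f : T -> R) : Prop :=
  mup.-integrable setT (EFin \o f) /\ mun.-integrable setT (EFin \o f).

Definition sint (d : measure_display) (T : measurableType d)
    (R : realType) (mup mun : {measure set T -> \bar R}) (D : set T) (f : T -> R) : R :=
  \int[mup]_(x in D) f x - \int[mun]_(x in D) f x.

(** * Distribution functions, V-functionals and marginals *)

Definition dF (R : realType) (H : cumulative R R) :
    {sigma_finite_measure set (measurableTypeR R) -> \bar R} :=
  lebesgue_stieltjes_measure H.

Definition V_functional (R : realType) (g : R * R -> R) (H : cumulative R R) :
    R := \int[(dF H \x dF H)%E]_z g z.

Definition marginal1 (R : realType) (g : R * R -> R) (F : cumulative R R)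
    (x : R) : R := \int[dF F]_y g (x, y).

Definition marginal2 (R : realType) (g : R * R -> R) (F : cumulative R R)
    (x : R) : R := \int[dF F]_y g (y, x).

Definition leftlim (R : realType) (h : R -> R) (x : R) : R :=
  lim (h y @[y --> x^'-]).

(** * Bounded cadlag functions on the extended real line *)

(** Right-continuity is vacuous at [+oo], existence of left limits at [-oo]. *)
Definition bcadlag (R : realType) : set (\bar R -> R) :=
  [set f | (exists M : R, forall x, `|f x| <= M) /\
    forall x : \bar R,
      (f @ within [set y | (x <= y)%E] (nbhs x) --> f x) /\
      (exists l : R, f @ within [set y | (y < x)%E] (nbhs x) --> l)].

Definition projection_sigma (R : realType) : set (set (\bar R -> R)) :=
  <<s @bcadlag R, [set A | exists (x : \bar R) (B : set R),
        measurable B /\ A = @bcadlag R `&` [set f | B (f x)]] >>.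

Definition trace_sigma (R : realType) (V : set (\bar R -> R)) :
    set (set (\bar R -> R)) :=
  [set A `&` V | A in @projection_sigma R].

Definition is_metric_on (R : realType) (U : Type) (V : set U)
    (rho : U -> U -> R) : Prop :=
  [/\ forall f h, V f -> V h -> 0 <= rho f h,
      forall f h, V f -> V h -> rho f h = 0 <-> f = h,
      forall f h, V f -> V h -> rho f h = rho h f
    & forall f h k, V f -> V h -> V k -> rho f k <= rho f h + rho h k].

(** [V] need not be a vector space, so the scaled functions are required to
    lie in [V], where [rho] is meaningful. *)
Definition homogeneous_on (R : realType) (V : set (\bar R -> R))
    (rho : (\bar R -> R) -> (\bar R -> R) -> R) : Prop :=
  forall (l : R) (f h : \bar R -> R), V f -> V h ->
    V (fun x => l * f x) -> V (fun x => l * h x) ->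
    rho (fun x => l * f x) (fun x => l * h x) = `|l| * rho f h.

Definition trace_measurable (R : realType) (V : set (\bar R -> R))
    (Phi : (\bar R -> R) -> R) : Prop :=
  forall B : set R, measurable B -> trace_sigma V (V `&` Phi @^-1` B).

Definition random_element (d : measure_display) (T : measurableType d)
    (R : realType) (V : set (\bar R -> R)) (xi : T -> \bar R -> R) : Prop :=
  (forall w, V (xi w)) /\
  forall A, trace_sigma V A -> measurable (xi @^-1` A).

Definition locally_holder (R : realType) (V : set (\bar R -> R))
    (rho : (\bar R -> R) -> (\bar R -> R) -> R) (beta : R)
    (Phi : (\bar R -> R) -> R) (f : \bar R -> R) : Prop :=
  V f /\
  forall u : nat -> \bar R -> R, (forall n, V (u n)) ->
    rho (u n) f @[n --> \oo] --> (0 : R) ->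
    (fun n => Phi (u n) - Phi f : R^o) =O_\oo
    (fun n => rho (u n) f `^ beta : R^o).

Definition extend (R : realType) (h : R -> R) (x : \bar R) : R :=
  match x with
  | r%:E => h r
  | +oo%E => lim (h y @[y --> +oo])
  | -oo%E => lim (h y @[y --> -oo])
  end.

(** * The functionals *)

Definition Phi_lin (R : realType) (psi : R -> R) (dpsi : stieltjes psi)
    (f : \bar R -> R) : R :=
  - sint (dpos dpsi) (dneg dpsi) setT (leftlim (f \o EFin)).

Definition Phi_lin_defined (R : realType) (psi : R -> R)
    (dpsi : stieltjes psi) (f : \bar R -> R) : Prop :=
  sintegrable (dpos dpsi) (dneg dpsi) (leftlim (f \o EFin)).

Definition Phi_quad (R : realType) (tau : R * R -> R) (dtau : stieltjes2 tau)
    (f : \bar R -> R) : R :=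
  sint (dpos2 dtau) (dneg2 dtau) setT
    (fun z => leftlim (f \o EFin) z.1 * leftlim (f \o EFin) z.2).

Definition Phi_quad_defined (R : realType) (tau : R * R -> R)
    (dtau : stieltjes2 tau) (f : \bar R -> R) : Prop :=
  sintegrable (dpos2 dtau) (dneg2 dtau)
    (fun z => leftlim (f \o EFin) z.1 * leftlim (f \o EFin) z.2).

(** * Estimators

    Indices are shifted by one: [X i] and [Fn n] stand for the (i+1)-st
    observation and the (n+1)-st estimator, so [Fn n] is based on
    [X 0], ..., [X n]. *)

Definition observation_sigma (d : measure_display) (T : measurableType d)
    (R : realType) (X : nat -> T -> R) (n : nat) : set (set T) :=
  <<s [set A | exists (i : nat) (B : set R),
        [/\ (i <= n)%N, measurable B & A = X i @^-1` B]] >>.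

Definition based_on (d : measure_display) (T : measurableType d)
    (R : realType) (X : nat -> T -> R) (Fn : nat -> T -> cumulative R R) :
    Prop :=
  forall (n : nat) (x : R) (B : set R), measurable B ->
    observation_sigma X n [set w | B (Fn n w x)].

Definition Hn (R : realType) (F G : cumulative R R) : R -> R :=
  fun x => G x - F x.

Definition Hn_ext (R : realType) (F G : cumulative R R) : \bar R -> R :=
  fun x => extend G x - extend F x.

(** * The regularity conditions *)

Definition condA1 (d : measure_display) (T : measurableType d) (R : realType)
    (P : probability T R) (g : R * R -> R) (F : cumulative R R)
    (Fn : nat -> T -> cumulative R R) : Prop :=
  [/\ (\int[dF F \x dF F]_z `|g z|%:E < +oo)%E,
      forall n w (a b : R), a <= b -> (total_variation a b (Fn n w) <= 1)%E
    & forall n, {ae P, forall w,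
        (\int[dF (Fn n w) \x dF (Fn n w)]_z `|g z|%:E < +oo)%E}].

Definition condA2 (d : measure_display) (T : measurableType d) (R : realType)
    (P : probability T R) (g : R * R -> R) (F : cumulative R R)
    (Fn : nat -> T -> cumulative R R) : Prop :=
  forall n,
    {ae P, forall w, (\int[dF (Fn n w) \x dF F]_z `|g z|%:E < +oo)%E} /\
    {ae P, forall w, (\int[dF F \x dF (Fn n w)]_z `|g z|%:E < +oo)%E}.

(** [Rintegral] is total, so the existence of the integrals defining the
    marginals at every point is a separate requirement. *)
Definition condA3 (R : realType) (g : R * R -> R) (F : cumulative R R) : Prop :=
  [/\ forall x : R, (dF F).-integrable setT (fun y => (g (x, y))%:E),
      forall x : R, (dF F).-integrable setT (fun y => (g (y, x))%:E),
      BV_loc_rc (marginal1 g F)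
    & BV_loc_rc (marginal2 g F)].

Definition condA4 (d : measure_display) (T : measurableType d) (R : realType)
    (P : probability T R) (F : cumulative R R)
    (Fn : nat -> T -> cumulative R R) (psi : R -> R) (dpsi : stieltjes psi) :
    Prop :=
  forall n, {ae P, forall w,
    (\int[dabs dpsi]_x `|leftlim (Hn F (Fn n w)) x|%:E < +oo)%E}.

Definition condA5 (d : measure_display) (T : measurableType d) (R : realType)
    (P : probability T R) (F : cumulative R R)
    (Fn : nat -> T -> cumulative R R) (psi : R -> R) : Prop :=
  forall n, {ae P, forall w,
    (Hn F (Fn n w) x * psi x @[x --> +oo] --> (0 : R)) /\
    (Hn F (Fn n w) x * psi x @[x --> -oo] --> (0 : R))}.

Definition condA6 (R : realType) (g : R * R -> R) : Prop :=
  [/\ BV2_loc_rc g,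
      forall x1 : R, locally_BV (fun x2 => g (x1, x2))
    & forall x2 : R, locally_BV (fun x1 => g (x1, x2))].

Definition condA7 (d : measure_display) (T : measurableType d) (R : realType)
    (P : probability T R) (F : cumulative R R)
    (Fn : nat -> T -> cumulative R R) (g : R * R -> R) (dg : stieltjes2 g) :
    Prop :=
  forall n, {ae P, forall w,
    (\int[dabs2 dg]_z
       (`|leftlim (Hn F (Fn n w)) z.1| * `|leftlim (Hn F (Fn n w)) z.2|)%:E
     < +oo)%E}.

(** [(a1, a2)] and [(b1, b2)] tend jointly to [(-oo, +oo)]. *)
Definition jointly_to0 (R : realType) (E : R -> R -> R -> R -> R) : Prop :=
  E z.1.1 z.1.2 z.2.1 z.2.2
    @[z --> filter_prod (filter_prod -oo_R +oo_R) (filter_prod -oo_R +oo_R)]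
    --> (0 : R).

Definition condA8 (d : measure_display) (T : measurableType d) (R : realType)
    (P : probability T R) (F : cumulative R R)
    (Fn : nat -> T -> cumulative R R) (g : R * R -> R)
    (dgl : forall x2 : R, stieltjes (fun x1 => g (x1, x2)))
    (dgr : forall x1 : R, stieltjes (fun x2 => g (x1, x2))) : Prop :=
  {ae P, forall w, forall n,
    let H := Hn F (Fn n w) in
    let I1 a1 a2 x2 :=
      sint (dpos (dgl x2)) (dneg (dgl x2)) `]a1, a2]%classic (leftlim H) in
    let I2 b1 b2 x1 :=
      sint (dpos (dgr x1)) (dneg (dgr x1)) `]b1, b2]%classic (leftlim H) in
    [/\ jointly_to0 (fun a1 a2 b1 b2 =>
          H b2 * I1 a1 a2 b2 - H b1 * I1 a1 a2 b1),
        jointly_to0 (fun a1 a2 b1 b2 =>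
          H a2 * I2 b1 b2 a2 - H a1 * I2 b1 b2 a1)
      & jointly_to0 (fun a1 a2 b1 b2 =>
          H a2 * H b2 * g (a2, b2) - H a1 * H b2 * g (a1, b2)
          - H a2 * H b1 * g (a2, b1) + H a1 * H b1 * g (a1, b1))]}.

(* Main.v *)
Require Import Defs.
From mathcomp Require Import measurable_realfun.
From mathcomp Require Import ring lra.

(** Write [H := G - F] for an estimate [G] of [F].  Expanding the product
    measure [dG dG = (dF + dH) (dF + dH)] and integrating by parts turns
    [V_g(G) - V_g(F)] into [Phi_1(H) + Phi_2(H) + Phi_3(H)]; the Hoelder bound
    at [0] and the rate [a_n d(F_n - F, 0) -> 0] then give the claim.

    Integration by parts over a bounded interval or rectangle is Tonelli's
    theorem for the indicator of [u <= x]: an increment [psi x - psi a] is the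
    signed mass of [(a, x]], and the [dK]-mass of [[u, b]] is [K b - K(u-)].
    In dimension two, [g z] is split into [g (a1, b1)], two one-dimensional
    increments along the lower edges and the rectangular increment, and each
    piece is treated in this way.  Letting the rectangle grow, the boundary
    terms vanish by (A5) and (A8). *)

Local Open Scope classical_set_scope.
Local Open Scope ring_scope.

(** * Tonelli's theorem for the sections of a set *)

Section sections.
Context (d1 d2 : measure_display) (T1 : measurableType d1)
  (T2 : measurableType d2) (R : realType).

(** Both sides are the product mass of [A] inside the rectangle with sides [D1] and [D2]. The
    measures [dpos] and [dneg] come as bare measures, finite on bounded sets, so Tonelli's theorem
    is applied to the finite restrictions to [D1] and [D2]. *)
Lemma integral_sections (m1 : {measure set T1 -> \bar R})
    (m2 : {measure set T2 -> \bar R})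
    (D1 : set T1) (D2 : set T2) (A : set (T1 * T2)) :
  measurable D1 -> measurable D2 -> measurable A ->
  (m1 D1 < +oo)%E -> (m2 D2 < +oo)%E ->
  [/\ m1.-integrable D1 (fun x => m2 (D2 `&` xsection A x)),
      m2.-integrable D2 (fun y => m1 (D1 `&` ysection A y)) &
   (\int[m1]_(x in D1) m2 (D2 `&` xsection A x) =
    \int[m2]_(y in D2) m1 (D1 `&` ysection A y))%E].
Proof.
move=> mD1 mD2 mA m1D1 m2D2.
pose n1 : {finite_measure set T1 -> \bar R} := mfrestr mD1 m1D1.
pose n2 : {finite_measure set T2 -> \bar R} := mfrestr mD2 m2D2.
have mB : measurable (A `&` D1 `*` D2) by apply: measurableI => //; exact: measurableX.
set B := A `&` D1 `*` D2 in mB.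
have xB x : D1 x -> D2 `&` xsection B x = D2 `&` xsection A x.
  move=> D1x; apply/seteqP; split=> y [D2y] /xsectionP; rewrite /xsection/= /B.
    by move=> [Axy _]; split => //=; rewrite inE.
  by move=> Axy; split => //=; rewrite inE.
have yB y : D2 y -> D1 `&` ysection B y = D1 `&` ysection A y.
  move=> D2y; apply/seteqP; split=> x [D1x] /ysectionP; rewrite /ysection/= /B.
    by move=> [Axy _]; split => //=; rewrite inE.
  by move=> Axy; split => //=; rewrite inE.
have F := indic_measurable_fun_fubini_tonelli_F n2 mB.
have G := indic_measurable_fun_fubini_tonelli_G n1 mB.
have := indic_fubini_tonelli n1 n2 mB.
rewrite indic_fubini_tonelli_FE// in F *.
rewrite indic_fubini_tonelli_GE// in G *.
have FE : {in D1, (n2 \o xsection B) =1 fun x => m2 (D2 `&` xsection A x)}.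
  move=> x; rewrite inE => D1x.
  by rewrite /= /mfrestr /mrestr setIC xB.
have GE : {in D2, (n1 \o ysection B) =1 fun y => m1 (D1 `&` ysection A y)}.
  by move=> y; rewrite inE => D2y; rewrite /= /mfrestr /mrestr setIC yB.
have bnd d (T : measurableType d) (m : {measure set T -> \bar R}) (D X : set T) :
    measurable D -> measurable X -> (m (D `&` X) <= m D)%E.
  by move=> mD mX; apply: le_measure; rewrite ?inE//; exact: measurableI.
(* A section has mass at most [m' D'] within [D'], and this finite constant is integrable over
   [D]. *)
have int d d' (T : measurableType d) (T' : measurableType d')
    (m : {measure set T -> \bar R}) (m' : {measure set T' -> \bar R})
    (D : set T) (D' : set T') (f : T -> set T') (h : T -> \bar R) :
    measurable D -> measurable D' -> (m D < +oo)%E -> (m' D' < +oo)%E ->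
    (forall x, measurable (f x)) ->
    measurable_fun setT h -> {in D, h =1 fun x => m' (D' `&` f x)} ->
    m.-integrable D (fun x => m' (D' `&` f x)).
  move=> mD mD' mDoo mDoo' mf mh hE.
  have mDf : m' D' \is a fin_num by rewrite ge0_fin_numE.
  apply: (@le_integrable _ _ _ m D mD _ (cst (m' D'))).
  - apply: (eq_measurable_fun h) => //.
    exact: measurable_funTS.
  - by move=> x Dx; rewrite !gee0_abs//=; exact: bnd.
  - rewrite -(fineK mDf).
    apply/integrableP; split; first exact: measurable_cst.
    by rewrite integral_cst// lte_mul_pinfty ?abse_ge0.
move=> E; split.
- apply: (int _ _ _ _ _ _ _ _ (xsection A) _ _ _ _ _ _ F) => // x.
  exact: measurable_xsection.
- apply: (int _ _ _ _ _ _ _ _ (ysection A) _ _ _ _ _ _ G) => // x.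
  exact: measurable_ysection.
(* Integrating over [D1] or over the whole space is the same, since the sections of [B] at points
   outside [D1] are empty. *)
transitivity (\int[n1]_x (n2 \o xsection B) x)%E.
  rewrite -(eq_integral _ _ FE).
  transitivity (\int[n1]_(x in D1) (n2 \o xsection B) x)%E.
    apply: eq_measure_integral => S mS SD1.
    by rewrite /= /mfrestr /mrestr setIidl.
  rewrite integral_mkcond; apply: eq_integral => x _.
  rewrite patchE; case: ifPn => //.
  rewrite notin_setE => D1x /=.
  rewrite (_ : xsection B x = set0) ?measure0//.
  by apply/seteqP; split=> // y /xsectionP [_ []].
rewrite E -(eq_integral _ _ GE).
transitivity (\int[n2]_(x in D2) (n1 \o ysection B) x)%E; last first.
  apply: eq_measure_integral => S mS SD1.
  by rewrite /= /mfrestr /mrestr setIidl.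
rewrite [RHS]integral_mkcond; apply: eq_integral => x _.
rewrite patchE; case: ifPn => //.
rewrite notin_setE => D1x /=.
rewrite (_ : ysection B x = set0) ?measure0//.
by apply/seteqP; split=> // y /ysectionP [_ []].
Qed.

(** Tonelli's theorem for [mp] and [mn] separately, then subtracted. With the section masses [h] and
    [k] as parameters, each integration by parts reduces to choosing [A] and computing its
    sections. *)
Lemma sint_sections (m1 : {measure set T1 -> \bar R})
    (mp mn : {measure set T2 -> \bar R}) (D1 : set T1) (D2 : set T2)
    (A : set (T1 * T2)) (h : T1 -> R) (k : T2 -> R) :
  measurable D1 -> measurable D2 -> measurable A ->
  (m1 D1 < +oo)%E -> (mp D2 < +oo)%E -> (mn D2 < +oo)%E ->
  (forall x, D1 x -> fine (mp (D2 `&` xsection A x))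
                   - fine (mn (D2 `&` xsection A x)) = h x) ->
  (forall y, D2 y -> m1 (D1 `&` ysection A y) = (k y)%:E) ->
  [/\ m1.-integrable D1 (EFin \o h), mp.-integrable D2 (EFin \o k),
      mn.-integrable D2 (EFin \o k) &
      \int[m1]_(x in D1) h x = sint mp mn D2 k].
Proof.
move=> mD1 mD2 mA m1D1 mpD2 mnD2 hE kE.
have [ip kp Ep] := integral_sections mD1 mD2 mA m1D1 mpD2.
have [im kn En] := integral_sections mD1 mD2 mA m1D1 mnD2.
have kE' : {in D2, (fun y => m1 (D1 `&` ysection A y)) =1 EFin \o k}.
  by move=> y; rewrite inE => /kE.
have fin (m2 : {measure set T2 -> \bar R}) x : (m2 D2 < +oo)%E ->
    m2 (D2 `&` xsection A x) = (fine (m2 (D2 `&` xsection A x)))%:E.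
  move=> m2D2; rewrite fineK// ge0_fin_numE//; apply: le_lt_trans m2D2.
  apply: le_measure; rewrite ?inE//; first apply: measurableI => //.
  exact: measurable_xsection.
have ip' : m1.-integrable D1 (EFin \o fun x => fine (mp (D2 `&` xsection A x))).
  by apply: eq_integrable ip => // x _; exact: fin.
have im' : m1.-integrable D1 (EFin \o fun x => fine (mn (D2 `&` xsection A x))).
  by apply: eq_integrable im => // x _; exact: fin.
split.
- apply: (eq_integrable mD1 (EFin \o ((fun x => fine (mp (D2 `&` xsection A x)))
     \- (fun x => fine (mn (D2 `&` xsection A x)))))).
    by move=> x; rewrite inE => D1x /=; rewrite hE.
  exact: (integrableB mD1 ip' im').
- exact: eq_integrable kp.
- exact: eq_integrable kn.
transitivity (\int[m1]_(x in D1) (fine (mp (D2 `&` xsection A x)) -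
   fine (mn (D2 `&` xsection A x)))).
  by apply: eq_Rintegral => x; rewrite inE => /hE.
rewrite RintegralB//; congr (_ - _); rewrite /Rintegral; congr fine.
- by rewrite -(eq_integral _ _ kE') -Ep; apply: eq_integral => x _; rewrite -fin.
- by rewrite -(eq_integral _ _ kE') -En; apply: eq_integral => x _; rewrite -fin.
Qed.

End sections.

(** * Left limits, and masses of intervals under a distribution function *)

Section dF.
Context (R : realType).
Implicit Types (K L : cumulative R R).

Lemma dF_itvoc K (a b : R) : a <= b -> dF K `]a, b]%classic = (K b - K a)%:E.
Proof.
move=> ab; rewrite /dF /= /lebesgue_stieltjes_measure /measure_extension.
rewrite measurable_mu_extE/=; last exact: is_ocitv.
by rewrite wlength_itv_bnd.
Qed.

(** [leftlim] is a [lim], meaningful only where the limit exists; here [K] is nondecreasing and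
    bounded above by [K u] to the left of [u]. *)
Lemma leftlim_cvg K (u : R) : K x @[x --> u^'-] --> leftlim K u.
Proof.
apply: nondecreasing_at_left_is_cvgr.
  by near=> x => y z _ _ yz; exact: cumulative_is_nondecreasing.
near=> x; exists (K u) => _ /= [s + <-]; rewrite in_itv/= => /andP[_ /ltW].
exact: cumulative_is_nondecreasing.
Unshelve. all: by end_near. Qed.

Lemma leftlimB K L (u : R) :
  leftlim (fun x => K x - L x) u = leftlim K u - leftlim L u.
Proof.
by apply: cvg_lim => //; apply: cvgB; exact: leftlim_cvg.
Qed.

(** Continuity from above along the intervals []u - 1/(n+1), b]], which decrease to [[u, b]]. This
    is where the left limits in the functionals come from. *)
Lemma dF_itvcc K (u b : R) : u <= b ->
  dF K `[u, b]%classic = (K b - leftlim K u)%:E.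
Proof.
move=> ub; pose I n : set (measurableTypeR R) := `]u - n.+1%:R^-1, b]%classic.
have IE n : dF K (I n) = (K b - K (u - n.+1%:R^-1))%:E.
  by rewrite dF_itvoc// lerBlDr (le_trans ub)// lerDl.
have <- : \bigcap_n I n = `[u, b]%classic.
  apply/seteqP; split=> x /=; rewrite !in_itv/=.
    move=> xI; have := xI 0%N Logic.I.
    rewrite /I /= in_itv/= => /andP[_ ->]; rewrite andbT leNgt; apply/negP => xu.
    (* If [x < u] and [n >= 1/(u - x)], then [x <= u - 1/(n+1)], so the [n]-th interval misses
       [x]. *)
    have := xI (Num.bound (u - x)^-1) Logic.I.
    rewrite /I /= in_itv/= => /andP[+ _]; apply/negP; rewrite -leNgt.
    rewrite lerBrDr -lerBrDl.
    rewrite invf_ple ?posrE ?subr_gt0//.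
    apply: (@le_trans _ _ (Num.bound (u - x)^-1)%:R); last by rewrite ler_nat.
    by apply/ltW; rewrite archi_boundP// invr_ge0 subr_ge0 ltW.
  move=> /andP[ux xb] n _; rewrite /I /= in_itv/= xb andbT.
  by rewrite ltrBlDr (le_lt_trans ux)// ltrDl.
have c1 : dF K \o I @ \oo --> dF K (\bigcap_n I n).
  apply: nonincreasing_cvg_mu.
  - by apply: (@eq_ind_r _ _ (fun x => (x < +oo)%E) _ _ (IE 0%N)); exact: ltry.
  - by move=> i; exact: measurable_itv.
  - by apply: bigcap_measurable => // i _; exact: measurable_itv.
  - move=> m n mn; apply/subsetPset/subset_itvr; rewrite bnd_simp lerB//.
    by rewrite lef_pV2 ?posrE// ler_nat.
have c2 : dF K \o I @ \oo --> (K b - leftlim K u)%:E.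
  rewrite (_ : _ \o _ = EFin \o (fun n => K b - K (u - n.+1%:R^-1))); last first.
    by apply/funext => n; exact: IE.
  apply: cvg_EFin; first by near=> n.
  apply: cvgB; first exact: cvg_cst.
  apply: (cvg_at_leftP _ _ _).1 (@leftlim_cvg K u) _ _; split.
    by move=> n; rewrite ltrBlDr ltrDl.
  rewrite -[X in _ --> X]subr0; apply: cvgB; first exact: cvg_cst.
  exact: cvg_harmonic.
exact: cvg_unique c1 c2.
Unshelve. all: by end_near. Qed.

End dF.

(** * Linearity of integrals against a difference of two measures *)

Section sint_theory.
Context (d : measure_display) (T : measurableType d) (R : realType).
Variables (mp mn : {measure set T -> \bar R}) (D : set T).
Hypothesis mD : measurable D.

(** A version of [sintegrable] localised to [D]: the left limit of a single distribution function is
    in general integrable on bounded sets only. *)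
Definition sintegrable_on (f : T -> R) : Prop :=
  mp.-integrable D (EFin \o f) /\ mn.-integrable D (EFin \o f).

Lemma eq_sintegrable_on f g : (forall x, D x -> f x = g x) ->
  sintegrable_on f -> sintegrable_on g.
Proof.
move=> fg [? ?]; split; apply: eq_integrable; try eassumption;
  by move=> x; rewrite inE => /fg /= ->.
Qed.

Lemma sintegrable_onB f g : sintegrable_on f -> sintegrable_on g ->
  sintegrable_on (fun x => f x - g x).
Proof.
move=> [f1 f2] [g1 g2].
by split; [exact: (integrableB mD f1 g1)|exact: (integrableB mD f2 g2)].
Qed.

Lemma sintegrable_onD f g : sintegrable_on f -> sintegrable_on g ->
  sintegrable_on (fun x => f x + g x).
Proof.
move=> [f1 f2] [g1 g2].
by split; [exact: (integrableD mD f1 g1)|exact: (integrableD mD f2 g2)].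
Qed.

Lemma sintegrable_onZ (c : R) f : sintegrable_on f ->
  sintegrable_on (fun x => c * f x).
Proof.
move=> [f1 f2].
by split; [exact: (integrableZl mD c f1)|exact: (integrableZl mD c f2)].
Qed.

Lemma eq_sint f g : (forall x, D x -> f x = g x) ->
  sint mp mn D f = sint mp mn D g.
Proof.
by move=> fg; congr (_ - _); apply: eq_Rintegral => x; rewrite inE => /fg.
Qed.

Lemma sintB f g : sintegrable_on f -> sintegrable_on g ->
  sint mp mn D (fun x => f x - g x) = sint mp mn D f - sint mp mn D g.
Proof. by move=> [? ?] [? ?]; rewrite /sint !RintegralB//; ring. Qed.

Lemma sintD f g : sintegrable_on f -> sintegrable_on g ->
  sint mp mn D (fun x => f x + g x) = sint mp mn D f + sint mp mn D g.
Proof. by move=> [? ?] [? ?]; rewrite /sint !RintegralD//; ring. Qed.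

Lemma sintZ (c : R) f : sintegrable_on f ->
  sint mp mn D (fun x => c * f x) = c * sint mp mn D f.
Proof. by move=> [? ?]; rewrite /sint !RintegralZl//; ring. Qed.

Lemma sint_cst (c : R) : sint mp mn D (fun=> c) = c * (fine (mp D) - fine (mn D)).
Proof. by rewrite /sint !Rintegral_cst// mulrBr. Qed.

Hypotheses (mpD : (mp D < +oo)%E) (mnD : (mn D < +oo)%E).

Lemma sintegrable_on_cst (c : R) : sintegrable_on (fun=> c).
Proof.
by split; apply/integrableP; (split; first exact: measurable_cst);
   rewrite integral_cst// lte_mul_pinfty.
Qed.

End sint_theory.

(** * Integration by parts on intervals and rectangles *)

Section by_parts.
Context (R : realType).
Implicit Types (K L : cumulative R R).
Local Notation TR := (measurableTypeR R).

(** Sets of the form [u <= x] are those to which Tonelli's theorem is applied; [f1] and [f2] pick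
    the coordinates to compare when a factor is the plane. *)
Lemma measurable_below (d1 d2 : measure_display) (T1 : measurableType d1)
    (T2 : measurableType d2) (f1 : T1 -> R) (f2 : T2 -> R) :
  measurable_fun setT f1 -> measurable_fun setT f2 ->
  measurable [set z : T1 * T2 | f2 z.2 <= f1 z.1].
Proof.
move=> m1 m2.
have m : measurable_fun setT (fun z : T1 * T2 => f2 z.2 <= f1 z.1).
  by apply: measurable_fun_ler; exact: measurableT_comp.
by have := m measurableT [set true]; rewrite setTI; exact.
Qed.

Lemma measurable_idR : measurable_fun [set: TR] (fun x : TR => x : R).
Proof. exact: (@measurable_id _ TR). Qed.

Lemma measurable_fstR : measurable_fun [set: TR * TR] (fun z : TR * TR => z.1 : R).
Proof. exact: (@measurable_fst _ _ TR TR). Qed.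

Lemma measurable_sndR : measurable_fun [set: TR * TR] (fun z : TR * TR => z.2 : R).
Proof. exact: (@measurable_snd _ _ TR TR). Qed.

Lemma dF_itv_lty K (a b : R) : (dF K `]a, b]%classic < +oo)%E.
Proof.
have [ab|ba] := leP a b; first by rewrite dF_itvoc// ltry.
by rewrite set_itv_ge ?measure0// bnd_simp -leNgt ltW.
Qed.

Lemma Rintegral_dF_cst K (a b c : R) : a <= b ->
  \int[dF K]_(x in `]a, b]) c = c * (K b - K a).
Proof.
move=> ab; rewrite Rintegral_cst; last exact: measurable_itv.
by congr (_ * _); exact: (congr1 fine (dF_itvoc K ab)).
Qed.

Lemma integrable_dF_cst K (a b c : R) :
  (dF K).-integrable `]a, b] (EFin \o cst c).
Proof.
rewrite [EFin \o _](_ : _ = cst c%:E)//.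
have mI : @measurable _ TR `]a, b] by exact: measurable_itv.
apply/integrableP; split; first exact: measurable_cst.
by rewrite integral_cst// lte_mul_pinfty// dF_itv_lty.
Qed.

(** The set [a < u <= x <= b] is measured by [dK] in [x] and [dpsi] in [u], in both orders. Fixing
    [x] gives the mass [psi x - psi a] of []a, x]]; fixing [u] gives the mass [K b - K(u-)] of
    [[u, b]]. *)
Lemma stieltjes_by_parts (psi : R -> R) (dpsi : stieltjes psi) K (a b : R) :
  a <= b ->
  [/\ (dF K).-integrable `]a, b] (EFin \o psi),
      sintegrable_on (dpos dpsi) (dneg dpsi) `]a, b] (leftlim K) &
      \int[dF K]_(x in `]a, b]) psi x =
      K b * psi b - K a * psi a
      - sint (dpos dpsi) (dneg dpsi) `]a, b] (leftlim K)].
Proof.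
move=> ab.
pose A : set (TR * TR) := [set z | z.2 <= z.1].
have mA : measurable A.
  exact: (measurable_below measurable_idR measurable_idR).
have mI : @measurable _ TR `]a, b] by exact: measurable_itv.
have hE (x : R) : `]a, b]%classic x ->
    fine (dpos dpsi (`]a, b]%classic `&` xsection A x))
    - fine (dneg dpsi (`]a, b]%classic `&` xsection A x)) = psi x - psi a.
  rewrite /= in_itv/= => /andP[ax xb].
  rewrite (_ : _ `&` _ = `]a, x]%classic) ?(stieltjesE dpsi) ?(ltW ax)//.
  apply/seteqP; split=> y; rewrite /= ?in_itv/=.
    by move=> [/andP[-> _]] /xsectionP.
  by move=> /andP[ay yx]; split; [rewrite ay (le_trans yx)|exact/xsectionP].
have kE (u : R) : `]a, b]%classic u ->
    dF K (`]a, b]%classic `&` ysection A u) = (K b - leftlim K u)%:E.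
  rewrite /= in_itv/= => /andP[au ub]; rewrite -dF_itvcc//; congr (dF K _).
  apply/seteqP; split=> y; rewrite /= ?in_itv/=.
    by move=> [/andP[_ ->]] /ysectionP; rewrite /A/= => ->.
  by move=> /andP[uy yb]; split; [rewrite yb (lt_le_trans au)|exact/ysectionP].
have [ih ikp ikn E] := sint_sections mI mI mA (dF_itv_lty K a b)
  (dpos_radon dpsi a b) (dneg_radon dpsi a b) hE kE.
have ic := sintegrable_on_cst mI (dpos_radon dpsi a b) (dneg_radon dpsi a b) (K b).
have iK : sintegrable_on (dpos dpsi) (dneg dpsi) `]a, b] (leftlim K).
  (* Tonelli yields integrability of the section mass [K b - K(u-)]; subtracting it from a constant
     recovers [K(u-)]. *)
  apply: (@eq_sintegrable_on _ _ _ _ _ _ mI (fun u => K b - (K b - leftlim K u))).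
    by move=> x _; ring.
  exact: sintegrable_onB.
have iF := integrable_dF_cst K a b (psi a).
have ipsi : (dF K).-integrable `]a, b] (EFin \o psi).
  apply: (eq_integrable mI (EFin \o ((fun x => psi x - psi a) \+ cst (psi a)))).
    by move=> x _ /=; congr EFin; ring.
  exact: (integrableD mI ih iF).
split => //.
rewrite sintB// sint_cst// (stieltjesE dpsi)// in E.
rewrite RintegralB// Rintegral_dF_cst// in E; lra.
Qed.

Lemma dF2_prod K L (A B : set TR) (x y : R) : measurable A -> measurable B ->
  dF K A = x%:E -> dF L B = y%:E -> (dF K \x dF L)%E (A `*` B) = (x * y)%:E.
Proof.
move=> mA mB KA LB; rewrite product_measure1E//.
by rewrite EFinM -KA -LB.
Qed.

Variables (g : R * R -> R) (dg : stieltjes2 g).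
Variable dgl : forall x2 : R, stieltjes (fun x1 => g (x1, x2)).
Variable dgr : forall x1 : R, stieltjes (fun x2 => g (x1, x2)).
Variables (a1 a2 b1 b2 : R).
Hypotheses (a12 : a1 <= a2) (b12 : b1 <= b2).

Local Notation D := (`]a1, a2]%classic `*` `]b1, b2]%classic : set (TR * TR)).
Local Notation sintg := (sint (dpos2 dg) (dneg2 dg) D).
Local Notation isintg := (sintegrable_on (dpos2 dg) (dneg2 dg) D).
Local Notation I1 K x2 :=
  (sint (dpos (dgl x2)) (dneg (dgl x2)) `]a1, a2]%classic (leftlim K)).
Local Notation I2 L x1 :=
  (sint (dpos (dgr x1)) (dneg (dgr x1)) `]b1, b2]%classic (leftlim L)).

Let mA : @measurable _ TR `]a1, a2]. Proof. exact: measurable_itv. Qed.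
Let mB : @measurable _ TR `]b1, b2]. Proof. exact: measurable_itv. Qed.
Let mD : measurable D. Proof. exact: measurableX. Qed.
Let dpD : (dpos2 dg D < +oo)%E. Proof. exact: dpos2_radon. Qed.
Let dnD : (dneg2 dg D < +oo)%E. Proof. exact: dneg2_radon. Qed.

(** The integrand depends on the second coordinate only, so [dg] acts through the increments of
    [g (a2, y) - g (a1, y)] in [y]. Both sides are compared through an integral against [dL], which
    avoids identifying a marginal of [dg] with a difference of the measures [dgr]. *)
Lemma stieltjes2_marginal2 L :
  isintg (fun z => leftlim L z.2) /\
  sintg (fun z => leftlim L z.2) = I2 L a2 - I2 L a1.
Proof.
pose A : set (TR * (TR * TR)) := [set z | z.2.2 <= z.1].
have mA' : measurable A.
  exact: (measurable_below measurable_idR measurable_sndR).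
have hE (y : R) : `]b1, b2]%classic y ->
    fine (dpos2 dg (D `&` xsection A y)) - fine (dneg2 dg (D `&` xsection A y))
    = g (a2, y) - g (a1, y) - (g (a2, b1) - g (a1, b1)).
  rewrite /= in_itv/= => /andP[b1y yb2].
  rewrite (_ : _ `&` _ = `]a1, a2]%classic `*` `]b1, y]%classic); last first.
    apply/seteqP; split=> -[u v]; rewrite /= ?in_itv/=.
      by move=> [[-> /andP[-> _]]] /xsectionP.
    move=> [au /andP[b1v vy]].
    by split; [rewrite au b1v (le_trans vy)|exact/xsectionP].
  by rewrite (stieltjes2E dg)//; [rewrite /increment2; ring|exact: ltW].
have kE (z : R * R) : D z -> dF L (`]b1, b2]%classic `&` ysection A z)
    = (L b2 - leftlim L z.2)%:E.
  case: z => u v; rewrite /= !in_itv/= => -[_ /andP[b1v vb2]].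
  rewrite -dF_itvcc//; congr (dF L _); apply/seteqP; split=> y; rewrite /= ?in_itv/=.
    by move=> [/andP[_ ->]] /ysectionP; rewrite /A/= => ->.
  by move=> /andP[vy yb]; split; [rewrite yb (lt_le_trans b1v)|exact/ysectionP].
have [ih ikp ikn E] := sint_sections mB mD mA' (dF_itv_lty L b1 b2) dpD dnD hE kE.
have ic := sintegrable_on_cst mD dpD dnD (L b2).
have iL : isintg (fun z => leftlim L z.2).
  apply: (@eq_sintegrable_on _ _ _ _ _ _ mD (fun z => L b2 - (L b2 - leftlim L z.2))).
    by move=> x _; ring.
  exact: sintegrable_onB.
split => //.
rewrite sintB// sint_cst// (stieltjes2E dg)// /increment2 in E.
(* One-dimensional integration by parts along the edges [x1 = a1] and [x1 = a2] produces the two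
   [I2] terms; the remaining boundary terms cancel against [L b2] times the increment of [g]. *)
have [i1 _ E1] := stieltjes_by_parts (dgr a1) L b12.
have [i2 _ E2] := stieltjes_by_parts (dgr a2) L b12.
have i21 := integrableB mB i2 i1.
rewrite RintegralB// in E; last exact: integrable_dF_cst.
rewrite RintegralB// Rintegral_dF_cst// E1 E2 in E.
lra.
Qed.

(** The mirror image of [stieltjes2_marginal2], with the horizontal edges and [dgl]. *)
Lemma stieltjes2_marginal1 K :
  isintg (fun z => leftlim K z.1) /\
  sintg (fun z => leftlim K z.1) = I1 K b2 - I1 K b1.
Proof.
pose A : set (TR * (TR * TR)) := [set z | z.2.1 <= z.1].
have mA' : measurable A.
  exact: (measurable_below measurable_idR measurable_fstR).
have hE (x : R) : `]a1, a2]%classic x ->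
    fine (dpos2 dg (D `&` xsection A x)) - fine (dneg2 dg (D `&` xsection A x))
    = g (x, b2) - g (x, b1) - (g (a1, b2) - g (a1, b1)).
  rewrite /= in_itv/= => /andP[a1x xa2].
  rewrite (_ : _ `&` _ = `]a1, x]%classic `*` `]b1, b2]%classic); last first.
    apply/seteqP; split=> -[u v]; rewrite /= ?in_itv/=.
      by move=> [[/andP[-> _] ->]] /xsectionP.
    move=> [/andP[a1u ux] bv].
    by split; [rewrite bv a1u (le_trans ux)|exact/xsectionP].
  by rewrite (stieltjes2E dg)//; [rewrite /increment2; ring|exact: ltW].
have kE (z : R * R) : D z -> dF K (`]a1, a2]%classic `&` ysection A z)
    = (K a2 - leftlim K z.1)%:E.
  case: z => u v; rewrite /= !in_itv/= => -[/andP[a1u ua2] _].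
  rewrite -dF_itvcc//; congr (dF K _); apply/seteqP; split=> y; rewrite /= ?in_itv/=.
    by move=> [/andP[_ ->]] /ysectionP; rewrite /A/= => ->.
  by move=> /andP[uy ya]; split; [rewrite ya (lt_le_trans a1u)|exact/ysectionP].
have [ih ikp ikn E] := sint_sections mA mD mA' (dF_itv_lty K a1 a2) dpD dnD hE kE.
have ic := sintegrable_on_cst mD dpD dnD (K a2).
have iK : isintg (fun z => leftlim K z.1).
  apply: (@eq_sintegrable_on _ _ _ _ _ _ mD (fun z => K a2 - (K a2 - leftlim K z.1))).
    by move=> x _; ring.
  exact: sintegrable_onB.
split => //.
rewrite sintB// sint_cst// (stieltjes2E dg)// /increment2 in E.
have [i1 _ E1] := stieltjes_by_parts (dgl b1) K a12.
have [i2 _ E2] := stieltjes_by_parts (dgl b2) K a12.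
have i21 := integrableB mA i2 i1.
rewrite RintegralB// in E; last exact: integrable_dF_cst.
rewrite RintegralB// Rintegral_dF_cst// E1 E2 in E.
lra.
Qed.

(** Stated for two monotone functions [K] and [L], whose product measure is positive; the case of
    [H] follows by bilinearity. *)
Lemma stieltjes2_by_parts K L :
  [/\ (dF K \x dF L)%E.-integrable D (EFin \o g),
      isintg (fun z => leftlim K z.1 * leftlim L z.2) &
      \int[(dF K \x dF L)%E]_(z in D) g z =
      sintg (fun z => leftlim K z.1 * leftlim L z.2)
      - (L b2 * I1 K b2 - L b1 * I1 K b1)
      - (K a2 * I2 L a2 - K a1 * I2 L a1)
      + (K a2 * L b2 * g (a2, b2) - K a1 * L b2 * g (a1, b2)
         - K a2 * L b1 * g (a2, b1) + K a1 * L b1 * g (a1, b1))].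
Proof.
pose m : {measure set (TR * TR) -> \bar R} := (dF K \x dF L)%E.
have mE (A B : set TR) (x y : R) : measurable A -> measurable B ->
  dF K A = x%:E -> dF L B = y%:E -> m (A `*` B) = (x * y)%:E.
  exact: dF2_prod.
have mDE : m D = ((K a2 - K a1) * (L b2 - L b1))%:E.
  by apply: mE => //; exact: dF_itvoc.
have mDoo : (m D < +oo)%E by rewrite mDE ltry.
(* One set for each nonconstant piece of [g]: [A0] for the rectangular increment, [Ar] for the
   increment along the edge [x1 = a1], [Al] for the one along [x2 = b1]. *)
pose A0 : set ((TR * TR) * (TR * TR)) :=
  [set z | z.2.1 <= z.1.1] `&` [set z | z.2.2 <= z.1.2].
pose Ar : set ((TR * TR) * TR) := [set z | z.2 <= z.1.2].
pose Al : set ((TR * TR) * TR) := [set z | z.2 <= z.1.1].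
have mA0 : measurable A0.
  apply: measurableI.
    exact: (measurable_below measurable_fstR measurable_fstR).
  exact: (measurable_below measurable_sndR measurable_sndR).
have mAr : measurable Ar.
  exact: (measurable_below measurable_sndR measurable_idR).
have mAl : measurable Al.
  exact: (measurable_below measurable_fstR measurable_idR).
have h0 (z : R * R) : D z ->
    fine (dpos2 dg (D `&` xsection A0 z)) - fine (dneg2 dg (D `&` xsection A0 z))
    = increment2 g a1 z.1 b1 z.2.
  case: z => x y; rewrite /= !in_itv/= => -[/andP[a1x xa2] /andP[b1y yb2]].
  rewrite (_ : _ `&` _ = `]a1, x]%classic `*` `]b1, y]%classic); last first.
    apply/seteqP; split=> -[u v]; rewrite /= ?in_itv/=.
      by move=> [[/andP[-> _] /andP[-> _]]] /xsectionP[].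
    move=> [/andP[a1u ux] /andP[b1v vy]]; split; last exact/xsectionP.
    by rewrite a1u b1v (le_trans ux)// (le_trans vy).
  by rewrite (stieltjes2E dg) ?ltW.
have k0 (z : R * R) : D z -> m (D `&` ysection A0 z) =
    ((K a2 - leftlim K z.1) * (L b2 - leftlim L z.2))%:E.
  case: z => u v; rewrite /= !in_itv/= => -[/andP[a1u ua2] /andP[b1v vb2]].
  rewrite (_ : _ `&` _ = `[u, a2]%classic `*` `[v, b2]%classic); last first.
    apply/seteqP; split=> -[x y]; rewrite /= ?in_itv/=.
      by move=> [[/andP[_ ->] /andP[_ ->]]] /ysectionP[/= -> ->].
    move=> [/andP[ux xa] /andP[vy yb]]; split; last exact/ysectionP.
    by rewrite xa yb (lt_le_trans a1u)// (lt_le_trans b1v).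
  by apply: mE; [exact: measurable_itv|exact: measurable_itv
                |exact: dF_itvcc|exact: dF_itvcc].
have hr (z : R * R) : D z -> fine (dpos (dgr a1) (`]b1, b2]%classic `&` xsection Ar z))
    - fine (dneg (dgr a1) (`]b1, b2]%classic `&` xsection Ar z))
    = g (a1, z.2) - g (a1, b1).
  case: z => x y; rewrite /= !in_itv/= => -[_ /andP[b1y yb2]].
  rewrite (_ : _ `&` _ = `]b1, y]%classic) ?(stieltjesE (dgr a1)) ?ltW//.
  apply/seteqP; split=> v; rewrite /= ?in_itv/=.
    by move=> [/andP[-> _]] /xsectionP.
  by move=> /andP[b1v vy]; split; [rewrite b1v (le_trans vy)|exact/xsectionP].
have kr v : `]b1, b2]%classic v -> m (D `&` ysection Ar v) =
    ((K a2 - K a1) * (L b2 - leftlim L v))%:E.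
  rewrite /= !in_itv/= => /andP[b1v vb2].
  rewrite (_ : _ `&` _ = `]a1, a2]%classic `*` `[v, b2]%classic); last first.
    apply/seteqP; split=> -[x y]; rewrite /= ?in_itv/=.
      by move=> [[-> /andP[_ ->]]] /ysectionP/= ->.
    move=> [-> /andP[vy yb]]; split; last exact/ysectionP.
    by rewrite yb (lt_le_trans b1v).
  by apply: mE; [exact: measurable_itv|exact: measurable_itv
                |exact: dF_itvoc|exact: dF_itvcc].
have hl (z : R * R) : D z -> fine (dpos (dgl b1) (`]a1, a2]%classic `&` xsection Al z))
    - fine (dneg (dgl b1) (`]a1, a2]%classic `&` xsection Al z))
    = g (z.1, b1) - g (a1, b1).
  case: z => x y; rewrite /= !in_itv/= => -[/andP[a1x xa2] _].
  rewrite (_ : _ `&` _ = `]a1, x]%classic) ?(stieltjesE (dgl b1)) ?ltW//.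
  apply/seteqP; split=> v; rewrite /= ?in_itv/=.
    by move=> [/andP[-> _]] /xsectionP.
  by move=> /andP[a1v vy]; split; [rewrite a1v (le_trans vy)|exact/xsectionP].
have kl u : `]a1, a2]%classic u -> m (D `&` ysection Al u) =
    ((K a2 - leftlim K u) * (L b2 - L b1))%:E.
  rewrite /= !in_itv/= => /andP[a1u ua2].
  rewrite (_ : _ `&` _ = `[u, a2]%classic `*` `]b1, b2]%classic); last first.
    apply/seteqP; split=> -[x y]; rewrite /= ?in_itv/=.
      by move=> [[/andP[_ ->] ->]] /ysectionP/= ->.
    move=> [/andP[ux xa] ->]; split; last exact/ysectionP.
    by rewrite xa (lt_le_trans a1u).
  by apply: mE; [exact: measurable_itv|exact: measurable_itv
                |exact: dF_itvcc|exact: dF_itvoc].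
have [i0 i0p i0n E0] := sint_sections mD mD mA0 mDoo dpD dnD h0 k0.
have [ir _ _ Er] := sint_sections mD mB mAr mDoo
  (dpos_radon (dgr a1) b1 b2) (dneg_radon (dgr a1) b1 b2) hr kr.
have [il _ _ El] := sint_sections mD mA mAl mDoo
  (dpos_radon (dgl b1) a1 a2) (dneg_radon (dgl b1) a1 a2) hl kl.
have [iL EL] := stieltjes2_marginal2 L.
have [iK EK] := stieltjes2_marginal1 K.
have ic c := sintegrable_on_cst mD dpD dnD c.
have iKL : isintg (fun z => leftlim K z.1 * leftlim L z.2).
  (* The product [(K a2 - K(u-)) (L b2 - L(v-))] is integrable as a section mass; what separates it
     from [K(u-) L(v-)] involves one coordinate at a time. *)
  apply: (@eq_sintegrable_on _ _ _ _ _ _ mD (fun z =>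
    (K a2 - leftlim K z.1) * (L b2 - leftlim L z.2)
    + (K a2 * leftlim L z.2 + (L b2 * leftlim K z.1 - K a2 * L b2)))).
    by move=> x _; ring.
  apply: sintegrable_onD => //.
  apply: sintegrable_onD => //; first exact: sintegrable_onZ.
  by apply: sintegrable_onB => //; exact: sintegrable_onZ.
have imc c : m.-integrable D (EFin \o cst c).
  rewrite [EFin \o _](_ : _ = cst c%:E)//.
  apply/integrableP; split; first exact: measurable_cst.
  by rewrite integral_cst// lte_mul_pinfty.
(* The four-term splitting of [g] based at the lower left corner [(a1, b1)]. *)
have gE : {in D, (fun z => increment2 g a1 z.1 b1 z.2
    + ((g (a1, z.2) - g (a1, b1)) + ((g (z.1, b1) - g (a1, b1)) + g (a1, b1)))) =1 g}.
  by move=> [x y] _; rewrite /increment2 /=; ring.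
have i3 := integrableD mD il (imc (g (a1, b1))).
have i2 := integrableD mD ir i3.
have i1 := integrableD mD i0 i2.
split => //.
  by apply: (eq_integrable mD) i1 => z zD /=; rewrite -(gE z zD).
rewrite -/m -(eq_Rintegral m gE).
rewrite (RintegralD mD i0 i2) (RintegralD mD ir i3) (RintegralD mD il (imc _)).
rewrite Rintegral_cst// mDE/= E0 Er El.
have [_ jL _] := stieltjes_by_parts (dgr a1) L b12.
have [_ jK _] := stieltjes_by_parts (dgl b1) K a12.
have jrc c := sintegrable_on_cst mB (dpos_radon (dgr a1) b1 b2)
  (dneg_radon (dgr a1) b1 b2) c.
have jlc c := sintegrable_on_cst mA (dpos_radon (dgl b1) a1 a2)
  (dneg_radon (dgl b1) a1 a2) c.
rewrite sintZ//; last exact: sintegrable_onB.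
rewrite sintB// sint_cst// (stieltjesE (dgr a1))//.
rewrite (@eq_sint _ TR _ _ _ _
  (fun u => (K a2 - leftlim K u) * (L b2 - L b1))
  (fun u => (L b2 - L b1) * (K a2 - leftlim K u))); last first.
  by move=> u _; rewrite mulrC.
rewrite sintZ//; last exact: sintegrable_onB.
rewrite sintB// sint_cst// (stieltjesE (dgl b1))//.
(* Expanding the product isolates the desired integrand and leaves terms in a single coordinate,
   evaluated by [EL] and [EK]. *)
rewrite (@eq_sint _ (TR * TR)%type _ _ _ _
  (fun z => (K a2 - leftlim K z.1) * (L b2 - leftlim L z.2))
  (fun z => leftlim K z.1 * leftlim L z.2 -
  (K a2 * leftlim L z.2 + (L b2 * leftlim K z.1 - K a2 * L b2)))); last first.
  by move=> u _; ring.
have jK2 := sintegrable_onZ mD (L b2) iK.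
have jL2 := sintegrable_onZ mD (K a2) iL.
have j1 := sintegrable_onB mD jK2 (ic (K a2 * L b2)).
have j2 := sintegrable_onD mD jL2 j1.
rewrite sintB// sintD// sintB// !sintZ// sint_cst// (stieltjes2E dg)// EL EK.
by rewrite /increment2; ring.
Qed.

End by_parts.

(** * Limits of integrals along exhausting sets *)

Section exhaustion.
Context (d : measure_display) (T : measurableType d) (R : realType).

(** Dominated convergence for [f] cut off outside [E n], with bound [|f|]: at each point the cut-off
    function eventually equals [f]. *)
Lemma Rintegral_exhaustion (mu : {measure set T -> \bar R}) (E : nat -> set T)
    (f : T -> R) :
  (forall n, measurable (E n)) -> (forall x, \forall n \near \oo, E n x) ->
  mu.-integrable setT (EFin \o f) ->
  \int[mu]_(x in E n) f x @[n --> \oo] --> \int[mu]_x f x.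
Proof.
move=> mE Ex intf.
have mf : measurable_fun setT (EFin \o f) by exact: measurable_int intf.
have [] := @dominated_convergence _ _ _ mu setT measurableT
  (fun n => (EFin \o f) \_ (E n)) (EFin \o f) (abse \o (EFin \o f)).
- by move=> n; apply/(measurable_restrictT _ (mE n)); exact: measurable_funTS.
- exact: mf.
- apply: aeW => x _; apply: cvg_near_cst.
  by apply: filterS (Ex x) => n En; rewrite patchE mem_set.
- exact: integrable_abse.
- apply: aeW => x n _; rewrite patchE; case: ifPn => //= _.
  by rewrite normr0 lee_fin.
move=> _ _ cv; rewrite /Rintegral; apply: fine_cvg.
rewrite fineK; last exact: integrable_fin_num.
by under eq_fun do rewrite integral_mkcond.
Qed.

Lemma sint_exhaustion (mp mn : {measure set T -> \bar R}) (E : nat -> set T)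
    (f : T -> R) :
  (forall n, measurable (E n)) -> (forall x, \forall n \near \oo, E n x) ->
  sintegrable mp mn f ->
  sint mp mn (E n) f @[n --> \oo] --> sint mp mn setT f.
Proof.
by move=> mE Ex [ip im]; apply: cvgB; exact: Rintegral_exhaustion.
Qed.

End exhaustion.

(** * Integration by parts for [H = G - F] on the line and the plane *)

Section expansion.
Context (R : realType).
Local Notation TR := (measurableTypeR R).

(** The joint limit is used along the squares with side []-n, n]], the sets that exhaust the
    plane. *)
Lemma jointly_to0_seq (E : R -> R -> R -> R -> R) : jointly_to0 E ->
  E (- n%:R) n%:R (- n%:R) n%:R @[n --> \oo] --> (0 : R).
Proof.
move=> E0.
have cy : n%:R @[n --> \oo] --> +oo_R by exact: cvgr_idn.
have cNy : - n%:R @[n --> \oo] --> -oo_R by rewrite -ninfty; apply: cvg_comp cy _.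
apply: (@cvg_comp _ _ _ (fun n : nat =>
  ((- n%:R : R, n%:R : R), (- n%:R : R, n%:R : R))) _ _ _ _ _ E0).
exact: (cvg_pair (cvg_pair cNy cy) (cvg_pair cNy cy)).
Qed.

Lemma itv_exhaustion (x : R) : \forall n \near \oo, `](- n%:R), n%:R]%classic x.
Proof.
near=> n; rewrite /= in_itv/=.
have : `|x| < n%:R by near: n; exact: nbhs_infty_gtr.
by rewrite ltr_norml => /andP[-> /ltW].
Unshelve. all: by end_near. Qed.

Variables (F G : cumulative R R).
Local Notation H := (Hn F G).

Lemma leftlim_Hn (u : R) : leftlim H u = leftlim G u - leftlim F u.
Proof. exact: leftlimB. Qed.

(** On a bounded interval the left limits of [G] and [F] are separately integrable, which permits
    the split. *)
Lemma sint_leftlim_Hn (psi : R -> R) (dpsi : stieltjes psi) (a b : R) : a <= b ->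
  sint (dpos dpsi) (dneg dpsi) `]a, b] (leftlim H) =
  sint (dpos dpsi) (dneg dpsi) `]a, b] (leftlim G) -
  sint (dpos dpsi) (dneg dpsi) `]a, b] (leftlim F).
Proof.
move=> ab; have [_ iF _] := stieltjes_by_parts dpsi F ab.
have [_ iG _] := stieltjes_by_parts dpsi G ab.
have mI : @measurable _ TR `]a, b] by exact: measurable_itv.
rewrite -(sintB mI iG iF).
by apply: eq_sint => u _; exact: leftlim_Hn.
Qed.

Lemma Hn_by_parts (psi : R -> R) (dpsi : stieltjes psi) (a b : R) : a <= b ->
  \int[dF G]_(x in `]a, b]) psi x - \int[dF F]_(x in `]a, b]) psi x =
  H b * psi b - H a * psi a
  - sint (dpos dpsi) (dneg dpsi) `]a, b] (leftlim H).
Proof.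
move=> ab; rewrite sint_leftlim_Hn// /Hn.
have [_ _ ->] := stieltjes_by_parts dpsi F ab.
have [_ _ ->] := stieltjes_by_parts dpsi G ab.
ring.
Qed.

(** [Hn_by_parts] on []-n, n]] as [n] grows: the integrals converge by exhaustion and the boundary
    terms vanish by assumption. *)
Lemma Rintegral_Hn (psi : R -> R) (dpsi : stieltjes psi) :
  (dF F).-integrable setT (EFin \o psi) ->
  (dF G).-integrable setT (EFin \o psi) ->
  sintegrable (dpos dpsi) (dneg dpsi) (leftlim H) ->
  H x * psi x @[x --> +oo] --> (0 : R) ->
  H x * psi x @[x --> -oo] --> (0 : R) ->
  \int[dF G]_x psi x - \int[dF F]_x psi x =
  - sint (dpos dpsi) (dneg dpsi) setT (leftlim H).
Proof.
move=> iF iG iH Hy HNy.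
pose I (n : nat) : set TR := `](- n%:R), n%:R]%classic.
have mI n : measurable (I n) by exact: measurable_itv.
have cy : (n%:R : R) @[n --> \oo] --> +oo_R by exact: cvgr_idn.
have cNy : (- n%:R : R) @[n --> \oo] --> -oo_R.
  by rewrite -ninfty; apply: cvg_comp cy _.
have cL : \int[dF G]_(x in I n) psi x - \int[dF F]_(x in I n) psi x @[n --> \oo]
    --> \int[dF G]_x psi x - \int[dF F]_x psi x.
  by apply: cvgB; apply: Rintegral_exhaustion => //; exact: itv_exhaustion.
have nn (n : nat) : - (n%:R : R) <= n%:R.
  by rewrite lerNl (le_trans _ (ler0n _ _))// oppr_le0.
have cR : H n%:R * psi n%:R - H (- n%:R) * psi (- n%:R)
    - sint (dpos dpsi) (dneg dpsi) (I n) (leftlim H) @[n --> \oo]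
    --> - sint (dpos dpsi) (dneg dpsi) setT (leftlim H).
  rewrite -[X in _ --> X]add0r; apply: cvgB; last first.
    by apply: sint_exhaustion => //; exact: itv_exhaustion.
  rewrite -[X in _ --> X](subr0 0); apply: cvgB.
    exact: (cvg_comp _ _ cy Hy).
  exact: (cvg_comp _ _ cNy HNy).
have LR n := Hn_by_parts dpsi (nn n).
by move: cL; rewrite (funext LR) => cL; exact: cvg_unique cL cR.
Qed.

Variables (g : R * R -> R) (dg : stieltjes2 g).
Variable dgl : forall x2 : R, stieltjes (fun x1 => g (x1, x2)).
Variable dgr : forall x1 : R, stieltjes (fun x2 => g (x1, x2)).

Let I1 a1 a2 x2 :=
  sint (dpos (dgl x2)) (dneg (dgl x2)) `]a1, a2]%classic (leftlim H).
Let I2 b1 b2 x1 :=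
  sint (dpos (dgr x1)) (dneg (dgr x1)) `]b1, b2]%classic (leftlim H).

(** Every term of [stieltjes2_by_parts] is bilinear in [K] and [L], so its alternating sum over the
    four choices from [G] and [F] puts [H] in both places. *)
Lemma Hn_by_parts2 (a1 a2 b1 b2 : R) : a1 <= a2 -> b1 <= b2 ->
  let D : set (TR * TR) := `]a1, a2]%classic `*` `]b1, b2]%classic in
  \int[(dF G \x dF G)%E]_(z in D) g z - \int[(dF G \x dF F)%E]_(z in D) g z
  - \int[(dF F \x dF G)%E]_(z in D) g z + \int[(dF F \x dF F)%E]_(z in D) g z =
  sint (dpos2 dg) (dneg2 dg) D (fun z => leftlim H z.1 * leftlim H z.2)
  - (H b2 * I1 a1 a2 b2 - H b1 * I1 a1 a2 b1)
  - (H a2 * I2 b1 b2 a2 - H a1 * I2 b1 b2 a1)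
  + (H a2 * H b2 * g (a2, b2) - H a1 * H b2 * g (a1, b2)
     - H a2 * H b1 * g (a2, b1) + H a1 * H b1 * g (a1, b1)).
Proof.
move=> a12 b12 D.
have mD : measurable D by apply: measurableX; exact: measurable_itv.
have [_ iGG EGG] := stieltjes2_by_parts dg dgl dgr a12 b12 G G.
have [_ iGF EGF] := stieltjes2_by_parts dg dgl dgr a12 b12 G F.
have [_ iFG EFG] := stieltjes2_by_parts dg dgl dgr a12 b12 F G.
have [_ iFF EFF] := stieltjes2_by_parts dg dgl dgr a12 b12 F F.
rewrite -/D in EGG EGF EFG EFF iGG iGF iFG iFF.
rewrite [X in X - _ - _ + _]EGG [X in _ - X - _ + _]EGF [X in _ - X + _]EFG.
rewrite [X in _ - _ - _ + X]EFF.
rewrite /I1 /I2.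
rewrite (sint_leftlim_Hn (dgl b1) a12) (sint_leftlim_Hn (dgl b2) a12).
rewrite (sint_leftlim_Hn (dgr a1) b12) (sint_leftlim_Hn (dgr a2) b12).
have -> : sint (dpos2 dg) (dneg2 dg) D (fun z => leftlim H z.1 * leftlim H z.2) =
    sint (dpos2 dg) (dneg2 dg) D (fun z => leftlim G z.1 * leftlim G z.2)
    - sint (dpos2 dg) (dneg2 dg) D (fun z => leftlim G z.1 * leftlim F z.2)
    - sint (dpos2 dg) (dneg2 dg) D (fun z => leftlim F z.1 * leftlim G z.2)
    + sint (dpos2 dg) (dneg2 dg) D (fun z => leftlim F z.1 * leftlim F z.2).
  have i1 := sintegrable_onB mD iGG iGF.
  have i2 := sintegrable_onB mD i1 iFG.
  rewrite -(sintB mD iGG iGF) -(sintB mD i1 iFG) -(sintD mD i2 iFF).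
  by apply: eq_sint => z _; rewrite !leftlim_Hn; ring.
by rewrite /Hn; ring.
Qed.

(** The identity on growing squares, passed to the limit on both sides. *)
Lemma Rintegral_Hn2 :
  (dF G \x dF G)%E.-integrable setT (EFin \o g) ->
  (dF G \x dF F)%E.-integrable setT (EFin \o g) ->
  (dF F \x dF G)%E.-integrable setT (EFin \o g) ->
  (dF F \x dF F)%E.-integrable setT (EFin \o g) ->
  sintegrable (dpos2 dg) (dneg2 dg) (fun z => leftlim H z.1 * leftlim H z.2) ->
  jointly_to0 (fun a1 a2 b1 b2 =>
    H b2 * I1 a1 a2 b2 - H b1 * I1 a1 a2 b1) ->
  jointly_to0 (fun a1 a2 b1 b2 =>
    H a2 * I2 b1 b2 a2 - H a1 * I2 b1 b2 a1) ->
  jointly_to0 (fun a1 a2 b1 b2 =>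
    H a2 * H b2 * g (a2, b2) - H a1 * H b2 * g (a1, b2)
    - H a2 * H b1 * g (a2, b1) + H a1 * H b1 * g (a1, b1)) ->
  \int[(dF G \x dF G)%E]_z g z - \int[(dF G \x dF F)%E]_z g z
  - \int[(dF F \x dF G)%E]_z g z + \int[(dF F \x dF F)%E]_z g z =
  sint (dpos2 dg) (dneg2 dg) setT (fun z => leftlim H z.1 * leftlim H z.2).
Proof.
move=> iGG iGF iFG iFF iH /jointly_to0_seq b1 /jointly_to0_seq b2 /jointly_to0_seq b3.
pose I (n : nat) : set TR := `](- n%:R), n%:R]%classic.
pose D n : set (TR * TR) := I n `*` I n.
have mD n : measurable (D n) by apply: measurableX; exact: measurable_itv.
have eD z : \forall n \near \oo, D n z.
  near=> n; split; near: n; exact: itv_exhaustion.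
have cGG := Rintegral_exhaustion mD eD iGG.
have cGF := Rintegral_exhaustion mD eD iGF.
have cFG := Rintegral_exhaustion mD eD iFG.
have cFF := Rintegral_exhaustion mD eD iFF.
have cL : (fun n => \int[(dF G \x dF G)%E]_(z in D n) g z
  - \int[(dF G \x dF F)%E]_(z in D n) g z
  - \int[(dF F \x dF G)%E]_(z in D n) g z
  + \int[(dF F \x dF F)%E]_(z in D n) g z) @ \oo -->
  \int[(dF G \x dF G)%E]_z g z - \int[(dF G \x dF F)%E]_z g z
  - \int[(dF F \x dF G)%E]_z g z + \int[(dF F \x dF F)%E]_z g z.
  exact: (cvgD (cvgB (cvgB cGG cGF) cFG) cFF).
have cR := sint_exhaustion mD eD iH.
(* The three boundary terms are added one at a time; each tends to 0, so the limit does not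
   change. *)
have {cR}/(_ eventually_filter)cR := cvgB cR b1.
have {cR}/(_ eventually_filter)cR := cvgB cR b2.
have {cR}/(_ eventually_filter)cR := cvgD cR b3.
rewrite !subr0 addr0 in cR.
rewrite -(cvg_lim (@Rhausdorff R) cL); apply: cvg_lim => //.
apply: cvg_trans cR; apply: near_eq_cvg; near=> n.
have nn : - (n%:R : R) <= n%:R.
  by rewrite lerNl (le_trans _ (ler0n _ _))// oppr_le0.
exact: (esym (Hn_by_parts2 nn nn)).
Unshelve. all: by end_near. Qed.

End expansion.

(** * Fubini's theorem for the marginals of [g] *)

Section marginals.
Context (R : realType) (g : R * R -> R) (F K : cumulative R R).
Local Notation TR := (measurableTypeR R).

(** Integrability of every section makes the inner integral finite at every point, so taking [fine]
    in [marginal1] loses nothing and Fubini's theorem applies to it directly. *)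
Lemma Rintegral_marginal1 :
  (forall x : R, (dF F).-integrable setT (fun y => (g (x, y))%:E)) ->
  (dF K \x dF F)%E.-integrable setT (EFin \o g) ->
  (dF K).-integrable setT (EFin \o marginal1 g F) /\
  \int[dF K]_x marginal1 g F x = \int[(dF K \x dF F)%E]_z g z.
Proof.
move=> ig iKF.
have E : fubini_F (dF F) (EFin \o g) = EFin \o marginal1 g F.
  apply/funext => x; rewrite /fubini_F /marginal1 /= /Rintegral fineK//.
  exact: integrable_fin_num.
split; first by rewrite -E; exact: integrable_fubini_F.
suff e : (\int[dF K]_x (EFin \o marginal1 g F) x = \int[dF K \x dF F]_z (g z)%:E)%E.
  exact: (congr1 fine e).
by rewrite -E; exact: integral12_prod_meas1.
Qed.

Lemma Rintegral_marginal2 :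
  (forall x : R, (dF F).-integrable setT (fun y => (g (y, x))%:E)) ->
  (dF F \x dF K)%E.-integrable setT (EFin \o g) ->
  (dF K).-integrable setT (EFin \o marginal2 g F) /\
  \int[dF K]_x marginal2 g F x = \int[(dF F \x dF K)%E]_z g z.
Proof.
move=> ig iFK.
have mg : measurable_fun setT (EFin \o g : TR * TR -> \bar R).
  exact: measurable_int iFK.
have E : fubini_G (dF F) (EFin \o g) = EFin \o marginal2 g F.
  apply/funext => x; rewrite /fubini_G /marginal2 /= /Rintegral fineK//.
  exact: integrable_fin_num.
split.
  (* The inner integral is bounded in absolute value by the inner integral of [|g|], whose outer
     integral is finite by Tonelli in the swapped order. *)
  rewrite -E; apply/integrableP; split; first exact: measurable_fubini_G iFK.
  apply: le_lt_trans ((integrable21ltyP _ _ mg).1 iFK).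
  apply: ge0_le_integral => //.
  - by apply: measurableT_comp => //; exact: measurable_fubini_G iFK.
  - apply: (@measurable_fun_fubini_tonelli_G _ _ _ _ _ (dF F)
      (abse \o (EFin \o g))) => //.
      exact: measurableT_comp.
    by move=> z; exact: abse_ge0.
  - move=> y _; apply: le_abse_integral => //.
    exact: (measurable_int _ (ig y)).
suff e : (\int[dF K]_x (EFin \o marginal2 g F) x = \int[dF F \x dF K]_z (g z)%:E)%E.
  exact: (congr1 fine e).
by rewrite -E; exact: integral21_prod_meas1.
Qed.

End marginals.

(** * Expansion of the V-functional around [F] *)

Section V_expansion.
Context (R : realType).
Variables (g : R * R -> R) (F G : cumulative R R).
Variables (dg1 : stieltjes (marginal1 g F)) (dg2 : stieltjes (marginal2 g F)).
Variable dg : stieltjes2 g.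
Variable dgl : forall x2 : R, stieltjes (fun x1 => g (x1, x2)).
Variable dgr : forall x1 : R, stieltjes (fun x2 => g (x1, x2)).
Local Notation H := (Hn F G).
Let I1 a1 a2 x2 :=
  sint (dpos (dgl x2)) (dneg (dgl x2)) `]a1, a2]%classic (leftlim H).
Let I2 b1 b2 x1 :=
  sint (dpos (dgr x1)) (dneg (dgr x1)) `]b1, b2]%classic (leftlim H).

Lemma V_functional_expansion :
  (dF G \x dF G)%E.-integrable setT (EFin \o g) ->
  (dF G \x dF F)%E.-integrable setT (EFin \o g) ->
  (dF F \x dF G)%E.-integrable setT (EFin \o g) ->
  (dF F \x dF F)%E.-integrable setT (EFin \o g) ->
  (forall x : R, (dF F).-integrable setT (fun y => (g (x, y))%:E)) ->
  (forall x : R, (dF F).-integrable setT (fun y => (g (y, x))%:E)) ->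
  Phi_lin_defined dg1 (Hn_ext F G) -> Phi_lin_defined dg2 (Hn_ext F G) ->
  Phi_quad_defined dg (Hn_ext F G) ->
  (H x * marginal1 g F x @[x --> +oo] --> (0 : R)) /\
  (H x * marginal1 g F x @[x --> -oo] --> (0 : R)) ->
  (H x * marginal2 g F x @[x --> +oo] --> (0 : R)) /\
  (H x * marginal2 g F x @[x --> -oo] --> (0 : R)) ->
  [/\ jointly_to0 (fun a1 a2 b1 b2 =>
        H b2 * I1 a1 a2 b2 - H b1 * I1 a1 a2 b1),
      jointly_to0 (fun a1 a2 b1 b2 =>
        H a2 * I2 b1 b2 a2 - H a1 * I2 b1 b2 a1)
    & jointly_to0 (fun a1 a2 b1 b2 =>
        H a2 * H b2 * g (a2, b2) - H a1 * H b2 * g (a1, b2)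
        - H a2 * H b1 * g (a2, b1) + H a1 * H b1 * g (a1, b1))] ->
  V_functional g G - V_functional g F =
  Phi_lin dg1 (Hn_ext F G) + Phi_lin dg2 (Hn_ext F G) + Phi_quad dg (Hn_ext F G).
Proof.
move=> iGG iGF iFG iFF ig1 ig2 p1 p2 p3 [l1y l1Ny] [l2y l2Ny] [j1 j2 j3].
have [mG1 EG1] := Rintegral_marginal1 ig1 iGF.
have [mF1 EF1] := Rintegral_marginal1 ig1 iFF.
have [mG2 EG2] := Rintegral_marginal2 ig2 iFG.
have [mF2 EF2] := Rintegral_marginal2 ig2 iFF.
(* On real arguments [Hn_ext F G] computes to [Hn F G], so well-definedness of the functionals is
   the integrability required here. *)
have e1 := Rintegral_Hn mF1 mG1 p1 l1y l1Ny.
have e2 := Rintegral_Hn mF2 mG2 p2 l2y l2Ny.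
have e3 := Rintegral_Hn2 iGG iGF iFG iFF p3 j1 j2 j3.
rewrite EG1 EF1 in e1; rewrite EG2 EF2 in e2.
(* The expansion of [dG dG - dF dF] into [dH dF + dF dH + dH dH], at the level of integrals. *)
have alg (gg gf fg ff q1 q2 q3 : R) : gf - ff = q1 -> fg - ff = q2 ->
    gg - gf - fg + ff = q3 -> gg - ff = q1 + q2 + q3.
  by move=> <- <- <-; ring.
exact: alg e1 e2 e3.
Qed.

End V_expansion.

(** * From a Hoelder bound to a rate of convergence *)

Section holder.
Context (R : realType).

Lemma powR_cvg0_seq (beta : R) (x : nat -> R) : 0 < beta ->
  (forall n, 0 <= x n) -> x n @[n --> \oo] --> (0 : R) ->
  x n `^ beta @[n --> \oo] --> (0 : R).
Proof.
move=> b0 x0 /cvgrPdist_lt cx; apply/cvgrPdist_lt => e e0.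
(* The threshold for [x n] is chosen so that its power [beta] is [e]. *)
have d0 : 0 < e `^ beta^-1 by exact: powR_gt0.
apply: filterS (cx _ d0) => n; rewrite !sub0r !normrN ger0_norm// => xd.
rewrite ger0_norm ?powR_ge0//.
have := gt0_ltr_powR b0 _ _ xd; rewrite -powRrM mulVf ?gt_eqF// powRr1 ?ltW//.
by apply; rewrite nnegrE// ltW.
Qed.

Lemma leftlim_cst (c : R) : leftlim (fun=> c) = fun=> c.
Proof.
by apply/funext => x; apply: cvg_lim => //; exact: cvg_cst.
Qed.

Lemma sint0 (d : measure_display) (T : measurableType d)
    (mp mn : {measure set T -> \bar R}) (D : set T) :
  sint mp mn D (fun=> 0) = 0.
Proof. by rewrite /sint /Rintegral !integral0 subrr. Qed.

(** Together with [Phi_quad0], this makes the Hoelder increment at the null function equal to the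
    functional itself. *)
Lemma Phi_lin0 (psi : R -> R) (dpsi : stieltjes psi) : Phi_lin dpsi (fun=> 0) = 0.
Proof.
rewrite /Phi_lin (_ : (fun=> 0) \o _ = fun=> 0)// leftlim_cst.
by rewrite [sint _ _ _ _]sint0 oppr0.
Qed.

Lemma Phi_quad0 (tau : R * R -> R) (dtau : stieltjes2 tau) :
  Phi_quad dtau (fun=> 0) = 0.
Proof.
rewrite /Phi_quad (_ : (fun=> 0) \o _ = fun=> 0)// leftlim_cst.
by under eq_fun do rewrite mulr0; exact: sint0.
Qed.

(** Since [|D n| <= k * r n ^ beta] eventually, the scaled sequence is bounded by
    [k * (a n * r n) ^ beta], which tends to 0. *)
Lemma holder_rate (r a D : nat -> R) (beta : R) : 0 < beta ->
  (forall n, 0 < a n) -> (forall n, 0 <= r n) ->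
  (D : nat -> R^o) =O_\oo (fun n => r n `^ beta : R^o) ->
  a n * r n @[n --> \oo] --> (0 : R) ->
  a n `^ beta * D n @[n --> \oo] --> (0 : R).
Proof.
move=> b0 a0 r0 /eqO_exP[k k0 Dk] ar0.
have c0 : k * (a n * r n) `^ beta @[n --> \oo] --> (0 : R).
  rewrite -[X in _ --> X](mulr0 k); apply: cvgMr.
  by apply: powR_cvg0_seq => // n; rewrite mulr_ge0// ltW.
apply/norm_cvg0P; apply: (squeeze_cvgr _ (cvg_cst 0) c0).
apply: filterS Dk => n Dn; apply/andP; split; first exact: normr_ge0.
rewrite normrM ger0_norm ?powR_ge0// powRM ?(ltW (a0 n))//.
rewrite mulrCA ler_wpM2l ?powR_ge0// (le_trans Dn)//.
apply: ler_wpM2l; first exact: ltW.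
by rewrite (ger0_norm (powR_ge0 (r n) beta)).
Qed.

End holder.

(** * Almost sure convergence of the scaled V-functionals *)

Theorem theorem3p23 (R : realType) (d : measure_display)
  (T : measurableType d) (P : probability T R)
  (X : nat -> {RV P >-> R}) (F : cumulativeBounded (0 : R) (1 : R))
  (Fn : nat -> T -> cumulative R R) (g : R * R -> R)
  (dg1 : stieltjes (marginal1 g F)) (dg2 : stieltjes (marginal2 g F))
  (dg : stieltjes2 g)
  (dgl : forall x2 : R, stieltjes (fun x1 => g (x1, x2)))
  (dgr : forall x1 : R, stieltjes (fun x2 => g (x1, x2)))
  (V : set (\bar R -> R)) (rho : (\bar R -> R) -> (\bar R -> R) -> R)
  (beta : R) (a : nat -> R)
  (X_dist : forall (i : nat) (x : R), cdf (X i) x = (F x)%:E)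
  (g_meas : measurable_fun setT g)
  (Fn_based : based_on X Fn)
  (V_sub : V `<=` @bcadlag R)
  (rho_metric : is_metric_on V rho)
  (rho_homogeneous : homogeneous_on V rho)
  (A1 : condA1 P g F Fn)
  (A2 : condA2 P g F Fn)
  (A3 : condA3 g F)
  (A4_1 : condA4 P F Fn dg1) (A4_2 : condA4 P F Fn dg2)
  (A5_1 : condA5 P F Fn (marginal1 g F)) (A5_2 : condA5 P F Fn (marginal2 g F))
  (A6 : condA6 g)
  (A7 : condA7 P F Fn dg)
  (A8 : condA8 P F Fn dgl dgr)
  (Phi_defined : forall f, V f ->
    [/\ Phi_lin_defined dg1 f, Phi_lin_defined dg2 f & Phi_quad_defined dg f])
  (Phi_meas : [/\ trace_measurable V (Phi_lin dg1),
    trace_measurable V (Phi_lin dg2) & trace_measurable V (Phi_quad dg)])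
  (beta_gt0 : 0 < beta)
  (Phi_holder : locally_holder V rho beta
    (fun f => Phi_lin dg1 f + Phi_lin dg2 f + Phi_quad dg f) (fun=> 0))
  (Hn_random : forall n, random_element V (fun w => Hn_ext F (Fn n w)))
  (a_gt0 : forall n, 0 < a n)
  (rate : {ae P, forall w,
    a n * rho (Hn_ext F (Fn n w)) (fun=> 0) @[n --> \oo] --> (0 : R)})
  (* not implied by [rate] when [a] is not bounded away from 0 *)
  (consistency : {ae P, forall w,
    rho (Hn_ext F (Fn n w)) (fun=> 0) @[n --> \oo] --> (0 : R)}) :
  {ae P, forall w,
    a n `^ beta * (V_functional g (Fn n w) - V_functional g F)
      @[n --> \oo] --> (0 : R)}.
Proof.
have [A1F _ A1n] := A1; have [ig1 ig2 _ _] := A3.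
have [V0 holder] := Phi_holder; have [rho0 _ _ _] := rho_metric.
(* Conditions holding almost surely for each [n] hold almost surely for all [n] at once, by
   countability; the argument then runs at a fixed sample point [w]. *)
have A2l := ae_foralln (fun n => (A2 n).1).
have A2r := ae_foralln (fun n => (A2 n).2).
apply: filter_app consistency; apply: filter_app rate; apply: filter_app A8.
apply: filter_app (ae_foralln A5_1); apply: filter_app (ae_foralln A5_2).
apply: filter_app A2l; apply: filter_app A2r; apply: filter_app (ae_foralln A1n).
apply: aeW => w iGG iFG iGF A5_2w A5_1w A8w ratew consw.
have int (m : {measure set (measurableTypeR R * measurableTypeR R) -> \bar R}) :
    (\int[m]_z `|g z|%:E < +oo)%E -> m.-integrable setT (EFin \o g).
  move=> h; apply/integrableP; split; last exact: h.
  apply/measurable_EFinP; exact: g_meas.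
have Vn n : V (Hn_ext F (Fn n w)) by have [] := Hn_random n.
have E n : V_functional g (Fn n w) - V_functional g F =
  Phi_lin dg1 (Hn_ext F (Fn n w)) + Phi_lin dg2 (Hn_ext F (Fn n w)) +
  Phi_quad dg (Hn_ext F (Fn n w)).
  have [p1 p2 p3] := Phi_defined _ (Vn n).
  apply: V_functional_expansion p1 p2 p3 (A5_1w n) (A5_2w n) (A8w n) => //.
  - exact: int (iGG n).
  - exact: int (iGF n).
  - exact: int (iFG n).
  - exact: int A1F.
apply: (@holder_rate R (fun n => rho (Hn_ext F (Fn n w)) (fun=> 0))) => //.
  by move=> n; exact: rho0.
(* The local Hoelder property speaks only of sequences tending to 0 in [rho], which [consw] provides
   for the paths at [w]. *)
have := holder _ Vn consw.
rewrite !Phi_lin0 Phi_quad0 !addr0.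
by under eq_fun do rewrite subr0 -E.
Qed.
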